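(* Let $f:(0,\infty)\to\mathbb{R}$ be a function. The following properties are equivalent. (i) There is an absolutely monotonic function $\varphi:[0,\infty)\to\mathbb{R}$ such that $$f(x)=\int_0^{\infty}e^{-xt}\varphi(t)\,dt\quad\text{for all } x>0$$ (in particular the integral converges for every $x>0$). (ii) There is a sequence $\{a_n\}_{n\geq 1}$ of real numbers with $a_n\geq 0$ such that for all integers $n\geq 0$ $$f(x)=\sum_{k=1}^{n}\frac{a_k}{x^k}+R_n(x),\quad x>0,$$ where $R_n$ is a completely monotonic function of order $n$. (iii) The function $x\mapsto(-1)^k(x^kf(x))^{(k)}$ is completely monotonic on $(0,\infty)$ for all integers $k\geq 0$. (iv) The function $x\mapsto(-1)^k(x^kf(x))^{(k)}$ is non-negative on $(0,\infty)$ for all integers $k\geq 0$. (v) We have $f(x)\geq 0$ and $(x^kf(x))^{(2k-1)}\leq 0$ for all $x>0$ and all integers $k\geq 1$.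
   Context: A function $\varphi:[0,\infty)\to\mathbb{R}$ is absolutely monotonic if it is infinitely often differentiable on $[0,\infty)$ and $\varphi^{(k)}(x)\geq 0$ for all $k\geq 0$ and all $x\geq 0$. A function $g:(0,\infty)\to\mathbb{R}$ is completely monotonic if it is infinitely often differentiable on $(0,\infty)$ and $(-1)^ng^{(n)}(x)\geq 0$ for all $n\geq 0$ and all $x>0$. A function $g:(0,\infty)\to\mathbb{R}$ is completely monotonic of order $\alpha>0$ if $x\mapsto x^{\alpha}g(x)$ is completely monotonic; completely monotonic of order $0$ means completely monotonic. In (iii), (iv) and (v) it is understood as part of the condition that the derivatives occurring there exist. *)

(* Defs.v *)
From Stdlib Require Import Reals.
From Coquelicot Require Import Coquelicot.
From mathcomp Require seq.
Open Scope R_scope.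

(* A function on [0,oo) or (0,oo) is represented by a total function R -> R,
   of which only the values on that interval matter. *)

(* [F k] is the [k]-th derivative of [f] relative to [D]: [D_in] takes
   difference quotients inside [D] only, so that derivatives at an endpoint
   of [D] are one-sided. *)
Definition derivatives_on (D : R -> Prop) (f : R -> R) (F : nat -> R -> R) : Prop :=
  (forall x, D x -> F 0%nat x = f x) /\
  (forall k x, D x -> D_in (F k) (F (S k)) D x).

Definition absolutely_monotonic (phi : R -> R) : Prop :=
  exists Phi : nat -> R -> R,
    derivatives_on (fun x => 0 <= x) phi Phi /\
    forall k x, 0 <= x -> 0 <= Phi k x.

(* [ex_derive_n g n x] only says that [Derive_n g (n - 1)], a total function,
   is differentiable at [x]; hence the quantification over all lower orders. *)
Definition derivable_up_to (n : nat) (g : R -> R) : Prop :=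
  forall j x, (j <= n)%nat -> 0 < x -> ex_derive_n g j x.

Definition completely_monotonic (g : R -> R) : Prop :=
  (forall n, derivable_up_to n g) /\
  (forall n x, 0 < x -> 0 <= (-1) ^ n * Derive_n g n x).

(* Intended for [0 <= alpha]; at [alpha = 0] the factor [Rpower x 0] is 1. *)
Definition completely_monotonic_of_order (alpha : R) (g : R -> R) : Prop :=
  completely_monotonic (fun x => Rpower x alpha * g x).

(* Main.v *)
Require Import Defs.
From Stdlib Require Import Reals List Lra Lia Factorial.
From Coquelicot Require Import Coquelicot.
From mathcomp Require seq.
Import ListNotations.
Open Scope R_scope.

(* Condition (i) says that [x f(x)] is an entire power series in [1/x] with nonnegative
   coefficients: [phi] is the entire series [sum_k e_k t^k], and monotone convergence
   integrates it term by term to [sum_k e_k k! / x^(k+1)].  Such a series splits as in (ii),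
   because a nonnegative entire series in [1/x] is completely monotonic; the [k]-th derivative
   kills the polynomial part of [x^k f], which gives (iii), (iv) and (v).
   From (iv), with [A_n = (x^n f)^(n)], the functions [(-1)^n A_n(1/y) / y^(n+1)] are the
   successive derivatives of [f(1/y) / y], so that Bernstein's theorem yields the series.
   From (v), [x f] is bounded at infinity, so [x^k f = O(x^(k-1))]; a wrong sign of a derivative
   of [x^k f] of order between [k] and [2k-1] would force faster growth, and (iv) follows. *)

(** * Successive derivatives on the half-line *)

(** An explicit family [G] lets derivatives be checked one [is_derive] at a time, at positive points
    only; [Derive_n] is recovered from it by uniqueness. *)
Definition derivs_upto (n : nat) (g : R -> R) (G : nat -> R -> R) : Prop :=
  (forall x, 0 < x -> G 0%nat x = g x) /\
  (forall k x, (k < n)%nat -> 0 < x -> is_derive (G k) x (G (S k) x)).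

Lemma locally_pos (x : R) : 0 < x -> locally x (fun y => 0 < y).
Proof. intros Hx; apply (open_gt 0 x Hx). Qed.

Lemma is_derive_ext_pos (g h : R -> R) (x l : R) :
  0 < x -> (forall y, 0 < y -> g y = h y) -> is_derive g x l -> is_derive h x l.
Proof.
  intros Hx Hgh Hg; apply is_derive_ext_loc with g; [|exact Hg].
  now apply filter_imp with (2 := locally_pos x Hx).
Qed.

Lemma derivs_upto_Derive_n (n : nat) (g : R -> R) (G : nat -> R -> R) :
  derivs_upto n g G -> forall k x, (k <= n)%nat -> 0 < x -> Derive_n g k x = G k x.
Proof.
  intros [H0 HS]; induction k as [|k IH]; intros x Hk Hx; simpl.
  - now rewrite H0.
  - apply is_derive_unique, is_derive_ext_pos with (G k); [exact Hx| |now apply HS].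
    intros y Hy; symmetry; apply IH; [lia|exact Hy].
Qed.

Lemma derivs_upto_derivable (n : nat) (g : R -> R) (G : nat -> R -> R) :
  derivs_upto n g G -> derivable_up_to n g.
Proof.
  intros HG [|j] x Hj Hx; simpl; [exact I|].
  exists (G (S j) x); apply is_derive_ext_pos with (G j); [exact Hx| |now apply HG].
  intros y Hy; symmetry; apply (derivs_upto_Derive_n n g G HG); [lia|exact Hy].
Qed.

Lemma derivable_derivs_upto (n : nat) (g : R -> R) :
  derivable_up_to n g -> derivs_upto n g (Derive_n g).
Proof.
  intros Hg; split; [reflexivity|].
  intros k x Hk Hx; apply Derive_correct; exact (Hg (S k) x Hk Hx).
Qed.

Lemma derivs_upto_ext (n : nat) (g h : R -> R) (G : nat -> R -> R) :
  (forall x, 0 < x -> g x = h x) -> derivs_upto n g G -> derivs_upto n h G.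
Proof.
  intros Hgh [H0 HS]; split; [|exact HS].
  intros x Hx; rewrite <- Hgh by exact Hx; now apply H0.
Qed.

Lemma derivs_upto_plus (n : nat) (g h : R -> R) (G H : nat -> R -> R) :
  derivs_upto n g G -> derivs_upto n h H ->
  derivs_upto n (fun x => g x + h x) (fun k x => G k x + H k x).
Proof.
  intros [G0 GS] [H0 HS]; split.
  - intros x Hx; now rewrite G0, H0.
  - intros k x Hk Hx; exact (is_derive_plus _ _ _ _ _ (GS k x Hk Hx) (HS k x Hk Hx)).
Qed.

(* Read off from [D^(m+1) (x u) = x D^(m+1) u + (m+1) D^m u] with [x u = g]. *)
Fixpoint quotient_derivs (G : nat -> R -> R) (m : nat) (x : R) : R :=
  match m with
  | 0%nat => G 0%nat x / x
  | S p => (G (S p) x - INR (S p) * quotient_derivs G p x) / x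
  end.

(** Serves to pass from [x^(n+1) f] to [x^n f]; the recurrence at the top order later links [A_n] to
    [A_(n+1)]. *)
Lemma derivs_upto_quotient (n : nat) (g : R -> R) (G : nat -> R -> R) :
  derivs_upto n g G -> derivs_upto n (fun x => g x / x) (quotient_derivs G).
Proof.
  intros [H0 HS]; split.
  - intros x Hx; simpl; now rewrite H0.
  - induction k as [|k IH]; intros x Hk Hx.
    + pose proof (HS 0%nat x Hk Hx) as H1; cbn [quotient_derivs].
      auto_derive.
      * split; [eexists; exact H1|split; [lra|exact I]].
      * replace (Derive (fun y => G 0%nat y) x) with (G 1%nat x)
          by (symmetry; apply is_derive_unique; exact H1).
        simpl; field; lra.
    + pose proof (HS (S k) x Hk Hx) as H1.
      assert (H2 := IH x ltac:(lia) Hx).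
      change (is_derive (fun y => (G (S k) y - INR (S k) * quotient_derivs G k y) / y) x
                ((G (S (S k)) x - INR (S (S k)) * quotient_derivs G (S k) x) / x)).
      rewrite (S_INR (S k)).
      assert (H3 : quotient_derivs G (S k) x = (G (S k) x - INR (S k) * quotient_derivs G k x) / x)
        by reflexivity.
      rewrite H3 in H2 |- *; clear H3.
      generalize dependent (INR (S k)); intros c H2.
      auto_derive.
      * repeat split; try (eexists; eassumption); lra.
      * replace (Derive (fun y => G (S k) y) x) with (G (S (S k)) x)
          by (symmetry; apply is_derive_unique; exact H1).
        replace (Derive (fun y => quotient_derivs G k y) x)
          with ((G (S k) x - c * quotient_derivs G k x) / x)
          by (symmetry; apply is_derive_unique; exact H2).
        field; lra.
Qed.

Lemma derivs_upto_monomial (c : R) (p m : nat) :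
  derivs_upto m (fun x => c * x ^ p) (fun k x => c * Derive_n (fun y => y ^ p) k x).
Proof.
  split; [reflexivity|]; intros k x _ _.
  exact (is_derive_scal _ x c _ (Derive_correct _ _ (ex_derive_n_pow (S k) p x))).
Qed.

(** Each product [x^n * (a_k / x^k)] with [1 <= k <= n] is a monomial of degree below [n], killed by
    [n] differentiations. *)
Lemma derivs_upto_laurent_head (a : nat -> R) (n N : nat) :
  (N <= n)%nat ->
  exists P : nat -> R -> R,
    (forall m, derivs_upto m (fun x => x ^ n * sum_n_m (fun k => a k / x ^ k) 1 N) P) /\
    forall k x, (n <= k)%nat -> P k x = 0.
Proof.
  induction N as [|N IH]; intros HN.
  - exists (fun _ _ => 0); split; [|reflexivity].
    intros m; split.
    + intros x _; rewrite sum_n_m_zero by lia; unfold zero; simpl; ring.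
    + intros k x _ _; exact (is_derive_const (0 : R) x).
  - destruct IH as [P [HP HP0]]; [lia|].
    exists (fun k x => P k x + a (S N) * Derive_n (fun y => y ^ (n - S N)) k x); split.
    + intros m.
      refine (derivs_upto_ext m _ _ _ _
                (derivs_upto_plus m _ _ _ _ (HP m) (derivs_upto_monomial (a (S N)) (n - S N) m))).
      intros x Hx; rewrite sum_n_Sm by lia;
      change (@plus _) with Rplus.
      replace (x ^ n) with (x ^ (n - S N) * x ^ S N) by (rewrite <- pow_add; f_equal; lia).
      assert (x ^ S N <> 0) by (apply pow_nonzero; lra).
      set (s := sum_n_m _ _ _); field; assumption.
    + intros k x Hk; rewrite HP0 by exact Hk; rewrite Derive_n_pow_bigi by lia; ring.
Qed.

(* The part of [x ^ k f] that is not completely monotonic is a polynomial of degree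
   less than [k], which [k] differentiations remove. *)
Lemma laurent_remainder_derivs (f : R -> R) (a : nat -> R) (Rk : R -> R) (k : nat) :
  completely_monotonic_of_order (INR k) Rk ->
  (forall x, 0 < x -> f x = sum_n_m (fun j => a j / x ^ j) 1 k + Rk x) ->
  (forall m, derivable_up_to m (fun y => y ^ k * f y)) /\
  forall i x, (k <= i)%nat -> 0 < x ->
    Derive_n (fun y => y ^ k * f y) i x = Derive_n (fun y => Rpower y (INR k) * Rk y) i x.
Proof.
  intros [Hd _] Hf.
  destruct (derivs_upto_laurent_head a k k (le_n k)) as [P [HP HP0]].
  assert (HG : forall m, derivs_upto m (fun y => y ^ k * f y)
      (fun i x => P i x + Derive_n (fun y => Rpower y (INR k) * Rk y) i x)).
  { intros m.
    refine (derivs_upto_ext m _ _ _ _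
              (derivs_upto_plus m _ _ _ _ (HP m) (derivable_derivs_upto m _ (Hd m)))).
    intros x Hx; cbv beta; rewrite Rpower_pow, (Hf x Hx) by exact Hx; ring. }
  split.
  - intros m; exact (derivs_upto_derivable m _ _ (HG m)).
  - intros i x Hi Hx.
    rewrite (derivs_upto_Derive_n i _ _ (HG i)) by auto.
    rewrite HP0 by exact Hi; ring.
Qed.

Lemma completely_monotonic_derivative (g : R -> R) (k : nat) :
  completely_monotonic g -> completely_monotonic (fun x => (-1) ^ k * Derive_n g k x).
Proof.
  intros [Hd Hs].
  assert (HG : forall n, derivs_upto n (fun x => (-1) ^ k * Derive_n g k x)
                 (fun i x => (-1) ^ k * Derive_n g (i + k) x)).
  { intros n; split; [reflexivity|]; intros i x _ Hx.
    apply is_derive_scal, Derive_correct; exact (Hd (S (i + k)) (S (i + k)) x (le_n _) Hx). }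
  split.
  - intros n; exact (derivs_upto_derivable n _ _ (HG n)).
  - intros n x Hx.
    rewrite (derivs_upto_Derive_n n _ _ (HG n)) by auto.
    rewrite <- Rmult_assoc, <- pow_add; exact (Hs (n + k)%nat x Hx).
Qed.

Lemma completely_monotonic_ext (g h : R -> R) :
  (forall x, 0 < x -> g x = h x) -> completely_monotonic g -> completely_monotonic h.
Proof.
  intros Hgh [Hd Hs].
  assert (HG : forall n, derivs_upto n h (Derive_n g)).
  { intros n; exact (derivs_upto_ext n g h _ Hgh (derivable_derivs_upto n g (Hd n))). }
  split.
  - intros n; exact (derivs_upto_derivable n _ _ (HG n)).
  - intros n x Hx; rewrite (derivs_upto_Derive_n n _ _ (HG n)) by auto; auto.
Qed.

(** * Growth at infinity *)

Lemma nonincreasing_of_derive (g g' : R -> R) (X : R) :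
  (forall x, X <= x -> is_derive g x (g' x)) -> (forall x, X <= x -> g' x <= 0) ->
  forall x y, X <= x -> x <= y -> g y <= g x.
Proof.
  intros Hd Hn x y Hx Hxy.
  destruct (MVT_gen g x y g') as [c [Hc Heq]];
    rewrite ?Rmin_left, ?Rmax_right in * by lra.
  - intros t Ht; apply Hd; lra.
  - intros t Ht; apply derivable_continuous_pt.
    exists (g' t); apply is_derive_Reals, Hd; lra.
  - assert (g' c <= 0) by (apply Hn; lra). nra.
Qed.

(** With [d = c / (j+1)] the function [g + d x^(j+1)] is nonincreasing beyond [X], so
    [g <= K - d x^(j+1)] there; half of [d] is given up to absorb the constant [K]. *)
Lemma antiderivative_growth (g g' : R -> R) (c X : R) (j : nat) :
  0 < c -> 0 <= X -> (forall x, X <= x -> is_derive g x (g' x)) ->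
  (forall x, X <= x -> g' x <= - c * x ^ j) ->
  exists c' X', 0 < c' /\ 0 <= X' /\ forall x, X' <= x -> g x <= - c' * x ^ S j.
Proof.
  intros Hc HX0 Hd Hle.
  assert (Hj : 0 < INR (S j)) by (apply lt_0_INR; lia).
  set (d := c / INR (S j)).
  assert (Hd0 : 0 < d) by (apply Rdiv_lt_0_compat; lra).
  set (K := g X + d * X ^ S j).
  (* Past [1], [x <= x^(j+1)]; past [2 K / d], [K <= (d / 2) x]. *)
  exists (d / 2), (Rmax (Rmax X 1) (2 * K / d)).
  assert (HM : X <= Rmax (Rmax X 1) (2 * K / d) /\ 1 <= Rmax (Rmax X 1) (2 * K / d)
               /\ 2 * K / d <= Rmax (Rmax X 1) (2 * K / d)).
  { pose proof (Rmax_l X 1); pose proof (Rmax_r X 1).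
    pose proof (Rmax_l (Rmax X 1) (2 * K / d)); pose proof (Rmax_r (Rmax X 1) (2 * K / d)).
    repeat split; lra. }
  split; [lra|split; [lra|]].
  intros x Hx.
  assert (HK : g x + d * x ^ S j <= K).
  { refine (nonincreasing_of_derive (fun t => g t + d * t ^ S j)
              (fun t => g' t + c * t ^ j) X _ _ X x _ _); [| |lra|lra].
    - intros t Ht; refine (is_derive_plus _ _ _ _ _ (Hd t Ht) _).
      replace (c * t ^ j) with (d * (INR (S j) * 1 * t ^ j)) by (unfold d; field; lra).
      apply is_derive_scal.
      exact (is_derive_pow (fun y => y) (S j) t 1 (is_derive_id t)).
    - intros t Ht; specialize (Hle t Ht); lra. }
  assert (Hp : x <= x ^ S j).
  { simpl; assert (1 <= x ^ j) by (apply pow_R1_Rle; lra); nra. }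
  assert (HKd : K <= d / 2 * x).
  { replace K with (d / 2 * (2 * K / d)) by (field; lra).
    apply Rmult_le_compat_l; lra. }
  assert (d / 2 * x <= d / 2 * x ^ S j) by (apply Rmult_le_compat_l; lra).
  lra.
Qed.

Lemma derivs_growth (n i : nat) (g : R -> R) (G : nat -> R -> R) (c X : R) :
  derivs_upto n g G -> (i <= n)%nat -> 0 < c -> 0 < X ->
  (forall x, X <= x -> G i x <= - c) ->
  exists c' X', 0 < c' /\ forall x, X' <= x -> g x <= - c' * x ^ i.
Proof.
  intros [H0 HS] Hi Hc HX Hle.
  assert (H : forall j, (j <= i)%nat ->
    exists c' X', 0 < c' /\ 0 < X' /\ forall x, X' <= x -> G (i - j)%nat x <= - c' * x ^ j).
  { induction j as [|j IH]; intros Hj.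
    - exists c, X; repeat split; auto; intros x Hx; rewrite Nat.sub_0_r.
      simpl; specialize (Hle x Hx); lra.
    - destruct IH as [c1 [X1 [Hc1 [HX1 H1]]]]; [lia|].
      destruct (antiderivative_growth (G (i - S j)%nat) (G (i - j)%nat) c1 X1 j)
        as [c2 [X2 [Hc2 [HX2 H2]]]]; [lra|lra| |exact H1|].
      + intros x Hx; replace (i - j)%nat with (S (i - S j)) by lia; apply HS; [lia|lra].
      (* Only [0 <= X2] is known; the shift makes the threshold positive, so that the derivatives
         exist beyond it. *)
      + exists c2, (X2 + 1); repeat split; [exact Hc2|lra|].
        intros x Hx; apply H2; lra. }
  destruct (H i (le_n i)) as [c' [X' [Hc' [HX' H']]]].
  exists c', X'; split; [exact Hc'|].
  intros x Hx; rewrite <- H0 by lra; rewrite Nat.sub_diag in H'; auto.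
Qed.

Lemma derivs_not_growth (n i k : nat) (g : R -> R) (G : nat -> R -> R) (c X M : R) :
  derivs_upto n g G -> (k < i <= n)%nat -> 0 < c -> 0 < X ->
  (forall x, X <= x -> G i x <= - c) ->
  ~ (forall x, 1 <= x -> - (M * x ^ k) <= g x).
Proof.
  intros HG Hi Hc HX Hle Hb.
  destruct (derivs_growth n i g G c X HG) as [c' [X' [Hc' H']]]; try lia; auto.
  (* [x >= 1] gives [x * x^k <= x^i], and [x > |M| / c'] gives [|M| < c' x]; together they
     contradict the lower bound. *)
  set (x := Rmax (Rmax X' 1) (Rabs M / c' + 1)).
  pose proof (Rmax_l X' 1); pose proof (Rmax_r X' 1).
  pose proof (Rmax_l (Rmax X' 1) (Rabs M / c' + 1)) as HA; fold x in HA.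
  pose proof (Rmax_r (Rmax X' 1) (Rabs M / c' + 1)) as HB; fold x in HB.
  specialize (H' x ltac:(lra)); specialize (Hb x ltac:(lra)).
  assert (Hp : x * x ^ k <= x ^ i) by (apply (Rle_pow x (S k) i); [lra|lia]).
  assert (Hk : 0 < x ^ k) by (apply pow_lt; lra).
  assert (Hcx : Rabs M < c' * x).
  { apply Rlt_le_trans with (c' * (Rabs M / c' + 1)).
    - replace (c' * (Rabs M / c' + 1)) with (Rabs M + c') by (field; lra); lra.
    - apply Rmult_le_compat_l; lra. }
  pose proof (Rle_abs M).
  assert (c' * (x * x ^ k) <= c' * x ^ i) by (apply Rmult_le_compat_l; lra).
  assert (M * x ^ k < c' * x * x ^ k) by (apply Rmult_lt_compat_r; lra).
  lra.
Qed.

(* A derivative of order above [k] that is monotone towards a wrong sign would force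
   growth of order above [x ^ k], so the sign propagates from each order to the one below. *)
Lemma alternating_derivs_descend (n k : nat) (g : R -> R) (G : nat -> R -> R) (M : R) :
  derivs_upto n g G -> (forall x, 1 <= x -> Rabs (g x) <= M * x ^ k) ->
  (forall x, 0 < x -> 0 <= (-1) ^ n * G n x) ->
  forall i x, (k < i <= n)%nat -> 0 < x -> 0 <= (-1) ^ i * G i x.
Proof.
  intros HG Hb Hn.
  assert (H : forall d i x, (i + d = n)%nat -> (k < i)%nat -> 0 < x -> 0 <= (-1) ^ i * G i x).
  { induction d as [|d IH]; intros i x Hd Hi Hx.
    - replace i with n by lia; auto.
    - destruct (Rle_lt_dec 0 ((-1) ^ i * G i x)) as [Hpos|Hneg]; [exact Hpos|exfalso].
      assert (Hscal : derivs_upto n (fun y => (-1) ^ i * g y) (fun j y => (-1) ^ i * G j y)).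
      { destruct HG as [H0 HS]; split.
        - intros y Hy; now rewrite H0.
        - intros j y Hj Hy; apply is_derive_scal; auto. }
      (* The derivative of [(-1)^i G_i] is [(-1)^i G_(i+1)], nonpositive by [IH], so beyond [x] the
         function stays below its negative value at [x]. *)
      refine (derivs_not_growth n i k _ _ (- ((-1) ^ i * G i x)) x M Hscal _ _ Hx _ _);
        [lia|lra| |].
      + intros y Hy; rewrite Ropp_involutive.
        refine (nonincreasing_of_derive (fun y => (-1) ^ i * G i y)
                  (fun y => (-1) ^ i * G (S i) y) x _ _ x y (Rle_refl x) Hy).
        * intros t Ht; apply Hscal; [lia|lra].
        * intros t Ht; assert (Ht0 : 0 < t) by lra.
          specialize (IH (S i) t ltac:(lia) ltac:(lia) Ht0); simpl in IH; lra.
      + intros y Hy; specialize (Hb y Hy).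
        assert (Habs : Rabs ((-1) ^ i * g y) <= M * y ^ k)
          by (rewrite Rabs_mult, pow_1_abs, Rmult_1_l; exact Hb).
        apply Rabs_le_between in Habs; lra. }
  intros i x Hi Hx; apply (H (n - i)%nat); try lia; exact Hx.
Qed.

(** * Functions with nonnegative derivatives *)

Lemma sum_f_R0_ge_last (u : nat -> R) (n : nat) :
  (forall k, 0 <= u k) -> u n <= sum_f_R0 u n.
Proof.
  intros Hu; destruct n as [|n]; simpl; [lra|].
  pose proof (cond_pos_sum u n Hu); lra.
Qed.

Lemma is_lim_seq_sum_f_R0 (u : nat -> nat -> R) (l : nat -> R) (n : nat) :
  (forall k, is_lim_seq (u k) (l k)) ->
  is_lim_seq (fun m => sum_f_R0 (fun k => u k m) n) (sum_f_R0 l n).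
Proof.
  intros Hu; induction n as [|n IH]; simpl; [apply Hu|].
  apply is_lim_seq_plus'; auto.
Qed.

(** Nothing is asked at [0], so that the notion fits both [phi] and [y |-> f(1/y) / y], which lives
    on the open half-line. *)
Definition nonneg_derivs (g : R -> R) (G : nat -> R -> R) : Prop :=
  (forall n, derivs_upto n g G) /\ forall n y, 0 < y -> 0 <= G n y.

Lemma nonneg_derivs_mono (g : R -> R) (G : nat -> R -> R) (n : nat) (x y : R) :
  nonneg_derivs g G -> 0 < x -> x <= y -> G n x <= G n y.
Proof.
  intros [HG HG0] Hx Hxy.
  pose proof (nonincreasing_of_derive (fun t => - G n t) (fun t => - G (S n) t) x) as H.
  cut (- G n y <= - G n x); [lra|].
  apply H; try lra.
  - intros t Ht; refine (is_derive_opp _ _ _ _); apply (HG (S n)); [lia|lra].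
  - intros t Ht; specialize (HG0 (S n) t); lra.
Qed.

Lemma nonneg_derivs_taylor (g : R -> R) (G : nat -> R -> R) (n : nat) (x y : R) :
  nonneg_derivs g G -> 0 < x < y ->
  exists z, x < z < y /\
    g y = sum_f_R0 (fun m => (y - x) ^ m / INR (fact m) * G m x) n
          + (y - x) ^ S n / INR (fact (S n)) * G (S n) z.
Proof.
  intros [HG HG0] Hxy.
  destruct (Taylor_Lagrange g n x y) as [z [Hz Heq]]; [lra| |].
  - intros t Ht k Hk; apply (derivs_upto_derivable (S n) g G (HG _)); [exact Hk|lra].
  - exists z; split; [exact Hz|].
    rewrite Heq, (derivs_upto_Derive_n (S n) g G (HG _) (S n) z) by (auto; lra).
    f_equal; apply sum_eq; intros i Hi.
    rewrite (derivs_upto_Derive_n i g G (HG _)) by (auto; lra); reflexivity.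
Qed.

Lemma taylor_term_nonneg (g : R -> R) (G : nat -> R -> R) (n : nat) (x h : R) :
  nonneg_derivs g G -> 0 < x -> 0 <= h -> 0 <= h ^ n / INR (fact n) * G n x.
Proof.
  intros [HG HG0] Hx Hh; apply Rmult_le_pos; [|auto].
  apply Rdiv_le_0_compat; [now apply pow_le|apply INR_fact_lt_0].
Qed.

(** All Taylor terms and the Lagrange remainder are nonnegative, so the value bounds each single
    term; this plays the role of a Cauchy estimate. *)
Lemma taylor_term_le (g : R -> R) (G : nat -> R -> R) (n : nat) (x h : R) :
  nonneg_derivs g G -> 0 < x -> 0 < h -> h ^ n / INR (fact n) * G n x <= g (x + h).
Proof.
  intros H Hx Hh.
  destruct (nonneg_derivs_taylor g G n x (x + h) H) as [z [Hz ->]]; [lra|].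
  replace (x + h - x) with h by ring.
  pose proof (taylor_term_nonneg g G (S n) z h H).
  pose proof (sum_f_R0_ge_last (fun m => h ^ m / INR (fact m) * G m x) n) as H1.
  cbv beta in H1; specialize (H1 (fun k => taylor_term_nonneg g G k x h H Hx (Rlt_le _ _ Hh))).
  lra.
Qed.

(** The remainder is at most [y^(n+1) / (n+1)! * G_(n+1)(y)]. Based at [y] with step [2 y], the same
    term is [2^(n+1)] times larger and still at most [g (3 y)]. The resulting bound is independent
    of [x], which allows [x -> 0]. *)
Lemma taylor_sum_bounds (g : R -> R) (G : nat -> R -> R) (n : nat) (x y : R) :
  nonneg_derivs g G -> 0 < x < y ->
  sum_f_R0 (fun m => (y - x) ^ m / INR (fact m) * G m x) n <= g y
  <= sum_f_R0 (fun m => (y - x) ^ m / INR (fact m) * G m x) n + g (3 * y) * (1 / 2) ^ S n.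
Proof.
  intros H Hxy; destruct (nonneg_derivs_taylor g G n x y H Hxy) as [z [Hz ->]].
  pose proof (taylor_term_nonneg g G (S n) z (y - x) H).
  assert (H1 : (y - x) ^ S n / INR (fact (S n)) * G (S n) z
               <= y ^ S n / INR (fact (S n)) * G (S n) y).
  { apply Rmult_le_compat; [|apply H; lra| |apply (nonneg_derivs_mono g); [exact H|lra|lra]].
    - apply Rdiv_le_0_compat; [apply pow_le; lra|apply INR_fact_lt_0].
    - apply Rmult_le_compat_r; [|apply pow_incr; lra].
      apply Rlt_le, Rinv_0_lt_compat, INR_fact_lt_0. }
  pose proof (taylor_term_le g G (S n) y (2 * y) H ltac:(lra) ltac:(lra)) as H2.
  replace (y + 2 * y) with (3 * y) in H2 by ring.
  assert (Hp : 0 < (1 / 2) ^ S n) by (apply pow_lt; lra).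
  apply Rmult_le_compat_r with (r := (1 / 2) ^ S n) in H2; [|lra].
  replace ((2 * y) ^ S n / INR (fact (S n)) * G (S n) y * (1 / 2) ^ S n)
    with (y ^ S n / INR (fact (S n)) * G (S n) y) in H2.
  - lra.
  - replace (y ^ S n) with ((2 * y) ^ S n * (1 / 2) ^ S n)
      by (rewrite <- Rpow_mult_distr; f_equal; lra).
    unfold Rdiv; ring.
Qed.

(* Taylor's formula at [x -> 0+]; the remainder is at most [g (3 y) / 2 ^ n]. *)
Lemma nonneg_derivs_pseries (g : R -> R) (G : nat -> R -> R) :
  nonneg_derivs g G ->
  exists b : nat -> R, (forall k, 0 <= b k) /\ forall y, 0 < y -> is_pseries b y (g y).
Proof.
  intros H; set (eps := fun m : nat => / INR (S m)).
  assert (Heps : forall m, 0 < eps m) by (intros m; apply Rinv_0_lt_compat, lt_0_INR; lia).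
  assert (Hlim0 : is_lim_seq eps 0).
  { change (is_lim_seq (fun m => / INR (S m)) (Rbar_inv p_infty)).
    apply is_lim_seq_inv; [|discriminate].
    apply -> is_lim_seq_incr_1; exact is_lim_seq_INR. }
  (* As [m] grows, [G k (eps m)] decreases and stays nonnegative, so [l k] is a true limit: the
     right limit of the [k]-th derivative at [0]. *)
  set (l := fun k => real (Lim_seq (fun m => G k (eps m)))).
  assert (Hl : forall k, is_lim_seq (fun m => G k (eps m)) (l k)).
  { intros k; apply Lim_seq_correct'.
    apply ex_finite_lim_seq_decr with 0; intros m; [|apply H; auto].
    apply (nonneg_derivs_mono g); [exact H|auto|].
    apply Rinv_le_contravar; [apply lt_0_INR; lia|apply le_INR; lia]. }
  assert (Hl0 : forall k, 0 <= l k).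
  { intros k.
    exact (is_lim_seq_le (fun _ => 0) _ 0 (l k) (fun m => proj2 H k _ (Heps m))
             (is_lim_seq_const 0) (Hl k)). }
  exists (fun k => l k / INR (fact k)); split.
  { intros k; apply Rdiv_le_0_compat; [auto|apply INR_fact_lt_0]. }
  intros y Hy.
  set (s := sum_f_R0 (fun k => y ^ k / INR (fact k) * l k)).
  assert (Hs : forall n, is_lim_seq
    (fun m => sum_f_R0 (fun k => (y - eps m) ^ k / INR (fact k) * G k (eps m)) n) (s n)).
  { intros n.
    apply (is_lim_seq_sum_f_R0 (fun k m => (y - eps m) ^ k / INR (fact k) * G k (eps m))
             (fun k => y ^ k / INR (fact k) * l k)).
    intros k; apply is_lim_seq_mult'; [|auto].
    apply is_lim_seq_mult'; [|apply is_lim_seq_const].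
    assert (Hc : continuity_pt (fun t => (y - t) ^ k) 0)
      by (apply derivable_continuous_pt, ex_derive_Reals_0; auto_derive; exact I).
    pose proof (is_lim_seq_continuous (fun t => (y - t) ^ k) eps 0 Hc Hlim0) as Hk.
    cbv beta in Hk; now rewrite Rminus_0_r in Hk. }
  (* Taylor's formula from [eps m] to [y] requires [eps m < y], which holds for all large [m]. *)
  assert (Hev : eventually (fun m => eps m < y)) by exact (Hlim0 _ (open_lt y 0 Hy)).
  assert (Hup : forall n, s n <= g y).
  { intros n; refine (is_lim_seq_le_loc _ (fun _ => g y) (s n) (g y) _ (Hs n) (is_lim_seq_const _)).
    apply filter_imp with (2 := Hev); intros m Hm.
    exact (proj1 (taylor_sum_bounds g G n (eps m) y H (conj (Heps m) Hm))). }
  assert (Hlo : forall n, g y - g (3 * y) * (1 / 2) ^ S n <= s n).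
  { intros n; refine (is_lim_seq_le_loc (fun _ => g y - g (3 * y) * (1 / 2) ^ S n) _
                        (Finite _) (s n) _ (is_lim_seq_const _) (Hs n)).
    apply filter_imp with (2 := Hev); intros m Hm.
    pose proof (proj2 (taylor_sum_bounds g G n (eps m) y H (conj (Heps m) Hm))); lra. }
  apply is_pseries_R.
  refine (is_lim_seq_ext s _ (g y) _ _).
  { intros n; rewrite sum_n_Reals; apply sum_eq; intros k _; unfold Rdiv; ring. }
  apply (is_lim_seq_le_le (fun n => g y - g (3 * y) * (1 / 2) ^ S n) s (fun _ => g y)).
  - intros n; split; auto.
  - replace (g y) with (g y - g (3 * y) * 0) at 1 by ring.
    apply is_lim_seq_minus'; [apply is_lim_seq_const|].
    apply is_lim_seq_mult'; [apply is_lim_seq_const|].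
    apply -> (is_lim_seq_incr_1 (fun n => (1 / 2) ^ n)).
    apply is_lim_seq_geom; rewrite Rabs_pos_eq; lra.
  - apply is_lim_seq_const.
Qed.

(** * Entire power series with nonnegative coefficients *)

Definition entire_nonneg (b : nat -> R) : Prop :=
  (forall k, 0 <= b k) /\ forall y, 0 < y -> ex_pseries b y.

(** Beyond a finite radius the terms of the series cannot tend to [0], which contradicts convergence
    at every positive point. *)
Lemma entire_nonneg_radius (b : nat -> R) : entire_nonneg b -> CV_radius b = p_infty.
Proof.
  intros [_ Hb].
  assert (H : forall y, 0 < y -> ~ Rbar_lt (CV_radius b) (Rabs y)).
  { intros y Hy Hlt; apply (CV_disk_outside b y Hlt), ex_series_lim_0.
    destruct (Hb y Hy) as [l Hl]; exists l; now apply is_pseries_R. }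
  destruct (CV_radius b) as [r| |]; [exfalso|reflexivity|exfalso].
  - apply (H (Rabs r + 1)); [pose proof (Rabs_pos r); lra|].
    simpl; pose proof (Rle_abs r); pose proof (Rle_abs (Rabs r + 1)); lra.
  - exact (H 1 Rlt_0_1 I).
Qed.

Lemma entire_nonneg_inside (b : nat -> R) (y : R) :
  entire_nonneg b -> Rbar_lt (Rabs y) (CV_radius b).
Proof. intros Hb; rewrite (entire_nonneg_radius b Hb); exact I. Qed.

Lemma entire_nonneg_of_radius (b : nat -> R) :
  (forall k, 0 <= b k) -> CV_radius b = p_infty -> entire_nonneg b.
Proof.
  intros H0 Hr; split; [exact H0|]; intros y _; apply CV_radius_inside; rewrite Hr; exact I.
Qed.

Lemma entire_nonneg_derive (b : nat -> R) : entire_nonneg b -> entire_nonneg (PS_derive b).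
Proof.
  intros Hb; apply entire_nonneg_of_radius.
  - intros k; apply Rmult_le_pos; [apply pos_INR|apply Hb].
  - rewrite CV_radius_derive; now apply entire_nonneg_radius.
Qed.

Lemma entire_nonneg_incr_1 (b : nat -> R) : entire_nonneg b -> entire_nonneg (PS_incr_1 b).
Proof.
  intros Hb; apply entire_nonneg_of_radius.
  - intros [|k]; [apply Rle_refl|apply Hb].
  - rewrite CV_radius_incr_1; now apply entire_nonneg_radius.
Qed.

Lemma entire_nonneg_decr_n (b : nat -> R) (n : nat) :
  entire_nonneg b -> entire_nonneg (PS_decr_n b n).
Proof.
  intros Hb; split; [intros k; apply Hb|]; intros y Hy.
  apply ex_pseries_decr_n; [right; exists (/ y); apply Rinv_l; lra|now apply Hb].
Qed.

Lemma entire_nonneg_mono (b : nat -> R) (x y : R) :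
  entire_nonneg b -> 0 <= x <= y -> PSeries b x <= PSeries b y.
Proof.
  intros Hb Hxy; apply Series_le.
  - intros k; split.
    + apply Rmult_le_pos; [apply Hb|apply pow_le; lra].
    + apply Rmult_le_compat_l; [apply Hb|apply pow_incr; lra].
  - destruct (CV_radius_inside b y (entire_nonneg_inside b y Hb)) as [l Hl].
    exists l; now apply is_pseries_R.
Qed.

Lemma entire_nonneg_pos (b : nat -> R) (y : R) :
  entire_nonneg b -> 0 <= y -> 0 <= PSeries b y.
Proof.
  intros Hb Hy; apply Rle_trans with (PSeries b 0).
  - rewrite PSeries_0; apply Hb.
  - apply entire_nonneg_mono; [exact Hb|lra].
Qed.

Lemma PSeries_taylor_head (b : nat -> R) (n : nat) (y : R) :
  entire_nonneg b ->
  PSeries b y = sum_f_R0 (fun k => b k * y ^ k) n + y ^ S n * PSeries (PS_decr_n b (S n)) y.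
Proof. intros Hb; apply PSeries_decr_n, CV_radius_inside; now apply entire_nonneg_inside. Qed.

(* [- d/dx] of [p (1/x)] is [q (1/x)] with [q y = y ^ 2 * p' y]. *)
Fixpoint inv_derivs_coef (b : nat -> R) (n : nat) : nat -> R :=
  match n with
  | 0%nat => b
  | S m => PS_incr_1 (PS_incr_1 (PS_derive (inv_derivs_coef b m)))
  end.

Lemma entire_inv_completely_monotonic (b : nat -> R) :
  entire_nonneg b -> completely_monotonic (fun x => PSeries b (/ x)).
Proof.
  intros Hb.
  assert (Hc : forall n, entire_nonneg (inv_derivs_coef b n)).
  { induction n as [|n IH]; [exact Hb|].
    now apply entire_nonneg_incr_1, entire_nonneg_incr_1, entire_nonneg_derive. }
  assert (HG : forall n, derivs_upto n (fun x => PSeries b (/ x))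
                 (fun k x => (-1) ^ k * PSeries (inv_derivs_coef b k) (/ x))).
  { intros n; split.
    - intros x _; simpl; ring.
    - intros k x _ Hx.
      change (inv_derivs_coef b (S k))
        with (PS_incr_1 (PS_incr_1 (PS_derive (inv_derivs_coef b k)))).
      rewrite !PSeries_incr_1.
      replace ((-1) ^ S k * _)
        with ((-1) ^ k * (- / (x * x) * PSeries (PS_derive (inv_derivs_coef b k)) (/ x)))
        by (simpl; field; lra).
      apply is_derive_scal.
      apply (is_derive_comp (PSeries (inv_derivs_coef b k)) Rinv).
      + apply is_derive_PSeries; now apply entire_nonneg_inside.
      + auto_derive; [lra|field; lra]. }
  split.
  - intros n; exact (derivs_upto_derivable n _ _ (HG n)).
  - intros n x Hx; rewrite (derivs_upto_Derive_n n _ _ (HG n)) by auto.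
    rewrite <- Rmult_assoc, <- Rpow_mult_distr.
    replace (-1 * -1) with 1 by ring; rewrite pow1, Rmult_1_l.
    apply entire_nonneg_pos; [apply Hc|apply Rlt_le; now apply Rinv_0_lt_compat].
Qed.

Lemma entire_absolutely_monotonic (b : nat -> R) :
  entire_nonneg b -> absolutely_monotonic (PSeries b).
Proof.
  intros Hb.
  set (c := nat_rect (fun _ => nat -> R) b (fun _ a => PS_derive a)).
  assert (Hc : forall n, entire_nonneg (c n)).
  { induction n as [|n IH]; [exact Hb|]; now apply (entire_nonneg_derive (c n)). }
  exists (fun k => PSeries (c k)); split; [split|].
  - reflexivity.
  - intros k x _; apply D_in_imp with no_cond; [intros; exact I|].
    apply derivable_pt_lim_D_in, is_derive_Reals.
    apply (is_derive_PSeries (c k)); now apply entire_nonneg_inside.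
  - intros k x Hx; now apply entire_nonneg_pos.
Qed.

Lemma absolutely_monotonic_pseries (phi : R -> R) :
  absolutely_monotonic phi ->
  exists e, entire_nonneg e /\ forall t, 0 < t -> phi t = PSeries e t.
Proof.
  intros [Phi [[H0 HS] Hpos]].
  assert (H : nonneg_derivs phi Phi).
  { split; [|intros n y Hy; apply Hpos; lra].
    intros n; split; [intros x Hx; apply H0; lra|].
    intros k x _ Hx; apply is_derive_Reals; intros eps Heps.
    destruct (HS k x (Rlt_le _ _ Hx) eps Heps) as [d [Hd Hd']].
    (* Increments smaller than [x] in absolute value stay inside the half-line, so the relative
       difference quotients there are the two-sided ones. *)
    assert (Hm : 0 < Rmin d x) by (apply Rmin_glb_lt; lra).
    exists (mkposreal _ Hm); intros h Hh Hhd; simpl in Hhd.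
    assert (Rabs h < d) by (apply Rlt_le_trans with (1 := Hhd), Rmin_l).
    assert (Hhx : Rabs h < x) by (apply Rlt_le_trans with (1 := Hhd), Rmin_r).
    apply Rabs_lt_between in Hhx.
    specialize (Hd' (x + h)); simpl in Hd'; unfold Rdist in Hd'.
    replace (x + h - x) with h in Hd' by ring.
    apply Hd'; repeat split; try lra; intros He; apply Hh; lra. }
  destruct (nonneg_derivs_pseries phi Phi H) as [e [He0 He]].
  exists e; split; [split; [exact He0|]|].
  - intros y Hy; exists (phi y); exact (He y Hy).
  - intros t Ht; symmetry; apply is_pseries_unique; auto.
Qed.

(** * Laplace transform of an entire series *)

(* [int_0^T exp (- x t) t ^ k dt], by the recurrence that integration by parts gives. *)
Fixpoint trunc_gamma (x : R) (k : nat) (T : R) : R :=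
  match k with
  | 0%nat => (1 - exp (- (x * T))) / x
  | S p => (INR (S p) * trunc_gamma x p T - exp (- (x * T)) * T ^ S p) / x
  end.

Lemma is_derive_trunc_gamma (x : R) (k : nat) (T : R) :
  0 < x -> is_derive (trunc_gamma x k) T (exp (- (x * T)) * T ^ k).
Proof.
  intros Hx; induction k as [|k IH].
  - unfold trunc_gamma; auto_derive; [exact I|field; lra].
  - change (is_derive
      (fun T => (INR (S k) * trunc_gamma x k T - exp (- (x * T)) * T ^ S k) / x) T
      (exp (- (x * T)) * T ^ S k)).
    auto_derive.
    + repeat split; eexists; eassumption.
    + replace (Derive (fun y => trunc_gamma x k y) T) with (exp (- (x * T)) * T ^ k)
        by (symmetry; apply is_derive_unique; exact IH).
      change (T ^ S k) with (T * T ^ k).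
      change (match k with 0%nat => 1 | S _ => INR k + 1 end) with (INR (S k)).
      rewrite !S_INR; simpl Init.Nat.pred; field; lra.
Qed.

Lemma trunc_gamma_0 (x : R) (k : nat) : 0 < x -> trunc_gamma x k 0 = 0.
Proof.
  intros Hx; induction k as [|k IH]; simpl trunc_gamma.
  - rewrite Rmult_0_r, Ropp_0, exp_0; field; lra.
  - rewrite IH; field; lra.
Qed.

Lemma continuous_exp_mult (x t : R) (h : R -> R) :
  continuous h t -> continuous (fun t => exp (- (x * t)) * h t) t.
Proof.
  intros Hh; apply (continuous_mult (fun t => exp (- (x * t))) h); [|exact Hh].
  apply (ex_derive_continuous (V := R_NormedModule)); auto_derive; exact I.
Qed.

Lemma continuous_pow (k : nat) (t : R) : continuous (fun t => t ^ k) t.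
Proof. apply (ex_derive_continuous (V := R_NormedModule)); auto_derive; exact I. Qed.

Lemma is_RInt_trunc_gamma (x : R) (k : nat) (T : R) : 0 < x ->
  is_RInt (fun t => exp (- (x * t)) * t ^ k) 0 T (trunc_gamma x k T).
Proof.
  intros Hx.
  replace (trunc_gamma x k T) with (minus (trunc_gamma x k T) (trunc_gamma x k 0)).
  - apply (is_RInt_derive (V := R_CompleteNormedModule) (trunc_gamma x k)).
    + intros t _; now apply is_derive_trunc_gamma.
    + intros t _; apply continuous_exp_mult, continuous_pow.
  - rewrite trunc_gamma_0 by exact Hx; apply Rminus_0_r.
Qed.

(** Dropping the nonnegative boundary term turns the recurrence into that of [k! / x^(k+1)]. *)
Lemma trunc_gamma_le (x : R) (k : nat) (T : R) :
  0 < x -> 0 <= T -> trunc_gamma x k T <= INR (fact k) / x ^ S k.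
Proof.
  intros Hx HT; assert (Hix : 0 < / x) by now apply Rinv_0_lt_compat.
  pose proof (exp_pos (- (x * T))) as He.
  induction k as [|k IH]; cbn [trunc_gamma].
  - rewrite pow_1; apply Rmult_le_compat_r; simpl; lra.
  - replace (INR (fact (S k)) / x ^ S (S k)) with (INR (S k) * (INR (fact k) / x ^ S k) / x).
    + apply Rmult_le_compat_r; [lra|].
      assert (0 <= exp (- (x * T)) * T ^ S k) by (apply Rmult_le_pos; [lra|now apply pow_le]).
      pose proof (Rmult_le_compat_l (INR (S k)) _ _ (pos_INR _) IH); lra.
    + rewrite fact_simpl, mult_INR; simpl pow; field; split; [apply pow_nonzero|]; lra.
Qed.

Lemma is_lim_exp_mult_pow (x : R) (k : nat) :
  0 < x -> is_lim (fun T => exp (- (x * T)) * T ^ k) p_infty 0.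
Proof.
  intros Hx.
  (* The term of order [k+1] in the series of [exp (x T)] bounds the function by [C / T]. *)
  set (C := INR (fact (S k)) / x ^ S k).
  apply (is_lim_le_le_loc (fun _ => 0) (fun T => C * / T)).
  - exists 0; intros T HT.
    assert (HxT : 0 < x * T) by now apply Rmult_lt_0_compat.
    pose proof (exp_ge_taylor (x * T) (S k) (Rlt_le _ _ HxT)) as H.
    pose proof (sum_f_R0_ge_last (fun j => (x * T) ^ j / INR (fact j)) (S k)) as H1.
    assert (H2 : (x * T) ^ S k / INR (fact (S k)) <= exp (x * T)).
    { apply Rle_trans with (2 := H), H1; intros j.
      apply Rdiv_le_0_compat; [apply pow_le; lra|apply INR_fact_lt_0]. }
    pose proof (pow_lt T k HT) as HTk; pose proof (INR_fact_lt_0 (S k)) as Hf.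
    pose proof (pow_lt x (S k) Hx) as Hxk.
    split; [apply Rmult_le_pos; [apply Rlt_le, exp_pos|lra]|].
    rewrite exp_Ropp.
    apply Rle_trans with (/ ((x * T) ^ S k / INR (fact (S k))) * T ^ k).
    + apply Rmult_le_compat_r; [lra|apply Rinv_le_contravar; [|exact H2]].
      apply Rdiv_lt_0_compat; [now apply pow_lt|exact Hf].
    + apply Req_le; unfold C; rewrite Rpow_mult_distr; simpl (T ^ S k).
      field; repeat split; lra.
  - apply is_lim_const.
  - replace (Finite 0) with (Rbar_mult C (Rbar_inv p_infty)) by (simpl; f_equal; ring).
    apply is_lim_scal_l, is_lim_inv; [apply is_lim_id|discriminate].
Qed.

Lemma is_lim_trunc_gamma (x : R) (k : nat) :
  0 < x -> is_lim (trunc_gamma x k) p_infty (INR (fact k) / x ^ S k).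
Proof.
  intros Hx.
  assert (Hs : forall (u : R -> R) (l : R),
    is_lim u p_infty l -> is_lim (fun T => u T / x) p_infty (l / x)).
  { intros u l Hu; exact (is_lim_scal_r u (/ x) p_infty l Hu). }
  induction k as [|k IH].
  - replace (INR (fact 0) / x ^ 1) with ((1 - 0) / x) by (simpl; field; lra).
    apply Hs, is_lim_minus'; [apply is_lim_const|].
    apply is_lim_ext with (2 := is_lim_exp_mult_pow x 0 Hx).
    intros T; simpl; ring.
  - replace (INR (fact (S k)) / x ^ S (S k)) with ((INR (S k) * (INR (fact k) / x ^ S k) - 0) / x).
    + apply Hs, is_lim_minus'; [|now apply is_lim_exp_mult_pow].
      exact (is_lim_scal_l _ (INR (S k)) p_infty _ IH).
    + rewrite fact_simpl, mult_INR; simpl pow; field; split; [apply pow_nonzero|]; lra.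
Qed.

Lemma is_RInt_sum_f_R0 (u : nat -> R -> R) (a b : R) (l : nat -> R) (n : nat) :
  (forall k, is_RInt (u k) a b (l k)) ->
  is_RInt (fun t => sum_f_R0 (fun k => u k t) n) a b (sum_f_R0 l n).
Proof.
  intros Hu; induction n as [|n IH]; simpl; [apply Hu|].
  exact (is_RInt_plus _ _ _ _ _ _ IH (Hu (S n))).
Qed.

Lemma is_RInt_laplace_head (e : nat -> R) (x T : R) (n : nat) : 0 < x ->
  is_RInt (fun t => exp (- (x * t)) * sum_f_R0 (fun k => e k * t ^ k) n) 0 T
    (sum_f_R0 (fun k => e k * trunc_gamma x k T) n).
Proof.
  intros Hx.
  apply (is_RInt_ext (fun t => sum_f_R0 (fun k => e k * (exp (- (x * t)) * t ^ k)) n)).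
  - intros t _; rewrite scal_sum; apply sum_eq; intros k _; ring.
  - apply (is_RInt_sum_f_R0 (fun k t => e k * (exp (- (x * t)) * t ^ k))).
    intros k; apply (is_RInt_scal (V := R_NormedModule)); now apply is_RInt_trunc_gamma.
Qed.

Lemma is_lim_laplace_head (e : nat -> R) (x : R) (n : nat) : 0 < x ->
  is_lim (fun T => sum_f_R0 (fun k => e k * trunc_gamma x k T) n) p_infty
    (sum_f_R0 (fun k => e k * (INR (fact k) / x ^ S k)) n).
Proof.
  intros Hx.
  assert (H : forall k, is_lim (fun T => e k * trunc_gamma x k T) p_infty
                          (e k * (INR (fact k) / x ^ S k))).
  { intros k; exact (is_lim_scal_l _ (e k) p_infty _ (is_lim_trunc_gamma x k Hx)). }
  induction n as [|n IH]; simpl sum_f_R0; [apply H|]; apply is_lim_plus'; auto.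
Qed.

Lemma ex_RInt_laplace (e : nat -> R) (x T : R) :
  entire_nonneg e -> ex_RInt (fun t => exp (- (x * t)) * PSeries e t) 0 T.
Proof.
  intros He; apply (ex_RInt_continuous (V := R_CompleteNormedModule)); intros t _.
  apply continuous_exp_mult, continuity_pt_filterlim, PSeries_continuity.
  now apply entire_nonneg_inside.
Qed.

Definition laplace_to (e : nat -> R) (x T : R) : R :=
  RInt (fun t => exp (- (x * t)) * PSeries e t) 0 T.

Lemma laplace_to_ge (e : nat -> R) (x T : R) (n : nat) :
  entire_nonneg e -> 0 < x -> 0 <= T ->
  sum_f_R0 (fun k => e k * trunc_gamma x k T) n <= laplace_to e x T.
Proof.
  intros He Hx HT.
  refine (is_RInt_le _ _ 0 T _ _ HT (is_RInt_laplace_head e x T n Hx)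
            (RInt_correct _ 0 T (ex_RInt_laplace e x T He)) _).
  intros t Ht; apply Rmult_le_compat_l; [apply Rlt_le, exp_pos|].
  rewrite (PSeries_taylor_head e n t He).
  assert (0 <= t ^ S n * PSeries (PS_decr_n e (S n)) t).
  { apply Rmult_le_pos; [apply pow_le; lra|].
    apply entire_nonneg_pos; [now apply entire_nonneg_decr_n|lra]. }
  lra.
Qed.

(** The tail of the series is nondecreasing in [t] and the exponential is at most [1], so the tail
    contributes at most [T] times its value at [T]. *)
Lemma laplace_to_le_tail (e : nat -> R) (x T : R) (n : nat) :
  entire_nonneg e -> 0 < x -> 0 <= T ->
  laplace_to e x T <= sum_f_R0 (fun k => e k * trunc_gamma x k T) n
    + T * (PSeries e T - sum_f_R0 (fun k => e k * T ^ k) n).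
Proof.
  intros He Hx HT.
  set (tail := fun t => PSeries e t - sum_f_R0 (fun k => e k * t ^ k) n).
  assert (Hc : is_RInt (fun _ => tail T) 0 T (T * tail T)).
  { replace (T * tail T) with (scal (T - 0) (tail T)) by (unfold scal; simpl; unfold mult; simpl; ring).
    exact (is_RInt_const 0 T (tail T)). }
  refine (is_RInt_le _ _ 0 T _ _ HT (RInt_correct _ 0 T (ex_RInt_laplace e x T He))
            (is_RInt_plus _ _ _ _ _ _ (is_RInt_laplace_head e x T n Hx) Hc) _).
  intros t Ht; change (plus ?u ?v) with (u + v).
  assert (Htail : 0 <= tail t <= tail T).
  { unfold tail; rewrite (PSeries_taylor_head e n t He), (PSeries_taylor_head e n T He).
    pose proof (entire_nonneg_decr_n e (S n) He) as Hd.
    pose proof (entire_nonneg_pos _ t Hd ltac:(lra)) as H0.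
    pose proof (entire_nonneg_mono _ t T Hd ltac:(lra)) as H1.
    assert (H2 : 0 <= t ^ S n) by (apply pow_le; lra).
    assert (H3 : t ^ S n <= T ^ S n) by (apply pow_incr; lra).
    pose proof (Rmult_le_pos _ _ H2 H0).
    pose proof (Rmult_le_compat _ _ _ _ H2 H0 H3 H1).
    lra. }
  replace (PSeries e t) with (sum_f_R0 (fun k => e k * t ^ k) n + tail t) by (unfold tail; ring).
  rewrite Rmult_plus_distr_l; apply Rplus_le_compat_l.
  assert (Hexp : exp (- (x * t)) <= 1).
  { rewrite <- exp_0; apply Rlt_le, exp_increasing; nra. }
  pose proof (exp_pos (- (x * t))).
  apply Rle_trans with (1 * tail t); [apply Rmult_le_compat_r; lra|lra].
Qed.

(** With [T] fixed and [n] growing, the tail at [T] vanishes; this stands in for uniform convergence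
    on [[0, T]]. *)
Lemma laplace_to_le (e : nat -> R) (x T S : R) :
  entire_nonneg e -> 0 < x -> 0 <= T ->
  (forall n, sum_f_R0 (fun k => e k * (INR (fact k) / x ^ Datatypes.S k)) n <= S) ->
  laplace_to e x T <= S.
Proof.
  intros He Hx HT HS.
  assert (Hl : is_lim_seq
    (fun n => S + T * (PSeries e T - sum_f_R0 (fun k => e k * T ^ k) n)) S).
  { replace (Finite S) with (Finite (S + T * (PSeries e T - PSeries e T))) by (f_equal; ring).
    apply is_lim_seq_plus'; [apply is_lim_seq_const|].
    apply is_lim_seq_mult'; [apply is_lim_seq_const|].
    apply is_lim_seq_minus'; [apply is_lim_seq_const|].
    refine (is_lim_seq_ext _ _ _ (sum_n_Reals (fun k => e k * T ^ k)) _).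
    apply (is_pseries_R e T), PSeries_correct, CV_radius_inside.
    now apply entire_nonneg_inside. }
  refine (is_lim_seq_le (fun _ => laplace_to e x T) _ (laplace_to e x T) S _
            (is_lim_seq_const _) Hl).
  intros n; apply Rle_trans with (1 := laplace_to_le_tail e x T n He Hx HT).
  apply Rplus_le_compat_r; apply Rle_trans with (2 := HS n).
  apply sum_Rle; intros k _; apply Rmult_le_compat_l; [apply He|now apply trunc_gamma_le].
Qed.

(** Monotone convergence by hand: for [T >= 0] the truncated integral lies below [S], and above the
    integrated head, whose limit in [T] is a partial sum of the series. *)
Lemma is_lim_laplace_to (e : nat -> R) (x S : R) :
  entire_nonneg e -> 0 < x ->
  is_series (fun k => e k * (INR (fact k) / x ^ Datatypes.S k)) S ->
  is_lim (laplace_to e x) p_infty S.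
Proof.
  intros He Hx HS.
  set (u := fun k => e k * (INR (fact k) / x ^ Datatypes.S k)) in *.
  assert (Hu0 : forall k, 0 <= u k).
  { intros k; apply Rmult_le_pos; [apply He|apply Rdiv_le_0_compat].
    - apply pos_INR.
    - now apply pow_lt. }
  assert (Hu : is_lim_seq (sum_f_R0 u) S)
    by exact (is_lim_seq_ext (sum_n u) _ S (sum_n_Reals u) HS).
  assert (Hle : forall n, sum_f_R0 u n <= S).
  { apply is_lim_seq_incr_compare; [exact Hu|].
    intros n; simpl; specialize (Hu0 (Datatypes.S n)); lra. }
  apply is_lim_spec; intros eps; simpl.
  apply is_lim_seq_spec in Hu.
  (* Half of [eps] pays for replacing [S] by a partial sum, the other half for truncating that sum's
     integrals at [T]. *)
  destruct (Hu (pos_div_2 eps)) as [n Hn]; specialize (Hn n (le_n n)); simpl in Hn.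
  assert (Hh : is_lim (fun T => sum_f_R0 (fun k => e k * trunc_gamma x k T) n) p_infty
                 (sum_f_R0 u n)) by exact (is_lim_laplace_head e x n Hx).
  apply is_lim_spec in Hh.
  destruct (Hh (pos_div_2 eps)) as [M HM]; simpl in HM.
  pose proof (cond_pos eps) as Heps.
  exists (Rmax M 0); intros T HT.
  pose proof (Rmax_l M 0); pose proof (Rmax_r M 0).
  specialize (HM T ltac:(lra)).
  pose proof (laplace_to_ge e x T n He Hx ltac:(lra)) as H1.
  pose proof (laplace_to_le e x T S He Hx ltac:(lra) Hle) as H2.
  apply Rabs_lt_between in Hn; apply Rabs_lt_between in HM.
  apply Rabs_lt_between; lra.
Qed.

(** As [T] grows in the lower bound, [F] bounds all partial sums of a nonnegative series, which
    therefore converges; its sum is [F] by [is_lim_laplace_to] and uniqueness of limits. *)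
Lemma laplace_series (e : nat -> R) (x F : R) :
  entire_nonneg e -> 0 < x -> is_lim (laplace_to e x) p_infty F ->
  is_series (fun k => e k * (INR (fact k) / x ^ S k)) F.
Proof.
  intros He Hx HF.
  set (u := fun k => e k * (INR (fact k) / x ^ S k)).
  assert (Hle : forall n, sum_n u n <= F).
  { intros n; rewrite sum_n_Reals.
    refine (is_lim_le_loc _ _ p_infty (sum_f_R0 u n) F _ (is_lim_laplace_head e x n Hx) HF).
    exists 0; intros T HT; apply laplace_to_ge; auto; lra. }
  assert (Hex : ex_series u).
  { destruct (ex_finite_lim_seq_incr (sum_n u) F) as [l Hl]; [|exact Hle|now exists l].
    intros n; rewrite sum_Sn; change (plus ?a ?b) with (a + b).
    assert (0 <= u (S n)); [|lra].
    apply Rmult_le_pos; [apply He|apply Rdiv_le_0_compat; [apply pos_INR|now apply pow_lt]]. }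
  destruct Hex as [l Hl].
  pose proof (is_lim_laplace_to e x l He Hx Hl) as HS.
  apply is_lim_unique in HF; apply is_lim_unique in HS.
  rewrite HF in HS; injection HS as ->; exact Hl.
Qed.

(** [at_point 0] fixes the lower end at exactly [0]; integrability on each [[0, T]] ties the total
    function [RInt] to actual integrals. *)
Lemma is_RInt_gen_p_infty (g : R -> R) (F : R) :
  (forall T, 0 < T -> ex_RInt g 0 T) ->
  is_RInt_gen g (at_point 0) (Rbar_locally p_infty) F <-> is_lim (RInt g 0) p_infty F.
Proof.
  intros Hg; split.
  - intros H P HP; destruct (H P HP) as [Q W HQ [M HW] HQW].
    exists (Rmax M 0); intros T HT.
    pose proof (Rmax_l M 0); pose proof (Rmax_r M 0).
    destruct (HQW 0 T HQ (HW T ltac:(lra))) as [y [Hy HPy]]; simpl in Hy.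
    now rewrite (is_RInt_unique _ _ _ _ Hy).
  - intros H P HP; destruct (H P HP) as [M HM].
    exists (fun t => t = 0) (fun T => Rmax M 0 < T).
    + reflexivity.
    + now exists (Rmax M 0).
    + intros t T -> HT; pose proof (Rmax_l M 0); pose proof (Rmax_r M 0).
      exists (RInt g 0 T); split; [apply (RInt_correct g), Hg; lra|apply HM; lra].
Qed.

(** * Entire series in [1/x] *)

(** The pivot of the implications from (i), (iv) and (v). The division by [x] makes the expansion
    start at [1/x], so that [a_k = b_(k-1)] in (ii). *)
Definition laurent_form (f : R -> R) (b : nat -> R) : Prop :=
  entire_nonneg b /\ forall x, 0 < x -> f x = PSeries b (/ x) / x.

Lemma laplace_integral_iff (f phi : R -> R) (e : nat -> R) (x : R) :
  entire_nonneg e -> (forall t, 0 < t -> phi t = PSeries e t) -> 0 < x ->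
  is_RInt_gen (fun t => exp (- (x * t)) * phi t) (at_point 0) (Rbar_locally p_infty) (f x) <->
  is_lim (laplace_to e x) p_infty (f x).
Proof.
  intros He Hphi Hx.
  assert (Hext : forall T t, 0 < T -> Rmin 0 T < t < Rmax 0 T ->
    exp (- (x * t)) * PSeries e t = exp (- (x * t)) * phi t).
  { intros T t HT Ht; rewrite Rmin_left in Ht by lra; now rewrite Hphi by lra. }
  rewrite is_RInt_gen_p_infty.
  - split; apply is_lim_ext_loc; exists 0; intros T HT; [symmetry|];
      apply RInt_ext; intros t Ht; apply (Hext T t HT Ht).
  - intros T HT; apply ex_RInt_ext with (2 := ex_RInt_laplace e x T He).
    intros t Ht; exact (Hext T t HT Ht).
Qed.

Lemma laplace_coef_term (b : nat -> R) (x : R) (k : nat) : 0 < x ->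
  b k / INR (fact k) * (INR (fact k) / x ^ S k) = / x * (b k * (/ x) ^ k).
Proof.
  intros Hx; pose proof (INR_fact_lt_0 k); rewrite pow_inv; simpl.
  assert (x ^ k <> 0) by (apply pow_nonzero; lra).
  field; repeat split; lra.
Qed.

Lemma laurent_form_of_laplace (f phi : R -> R) :
  absolutely_monotonic phi ->
  (forall x, 0 < x -> is_RInt_gen (fun t => exp (- (x * t)) * phi t)
     (at_point 0) (Rbar_locally p_infty) (f x)) ->
  exists b, laurent_form f b.
Proof.
  intros Hphi Hf.
  destruct (absolutely_monotonic_pseries phi Hphi) as [e [He Hpe]].
  set (b := fun k => e k * INR (fact k)).
  assert (Hb : forall x, 0 < x -> is_pseries b (/ x) (x * f x)).
  { intros x Hx.
    pose proof (proj1 (laplace_integral_iff f phi e x He Hpe Hx) (Hf x Hx)) as H.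
    pose proof (is_series_scal x _ _ (laplace_series e x (f x) He Hx H)) as H1.
    apply is_pseries_R; refine (is_series_ext _ _ _ _ H1).
    intros k; change (x * (e k * (INR (fact k) / x ^ S k)) = b k * (/ x) ^ k); unfold b; rewrite pow_inv; simpl pow.
    assert (x ^ k <> 0) by (apply pow_nonzero; lra); field; lra. }
  exists b; split; [split|].
  - intros k; apply Rmult_le_pos; [apply He|apply pos_INR].
  - intros y Hy; exists (/ y * f (/ y)).
    pose proof (Hb (/ y) (Rinv_0_lt_compat y Hy)) as H; now rewrite Rinv_inv in H.
  - intros x Hx; rewrite (is_pseries_unique _ _ _ (Hb x Hx)); field; lra.
Qed.

Lemma laplace_of_laurent_form (f : R -> R) (b : nat -> R) :
  laurent_form f b ->
  exists phi, absolutely_monotonic phi /\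
    forall x, 0 < x -> is_RInt_gen (fun t => exp (- (x * t)) * phi t)
      (at_point 0) (Rbar_locally p_infty) (f x).
Proof.
  intros [Hb Hf].
  set (e := fun k => b k / INR (fact k)).
  (* Since [k! >= 1], [e_k <= b_k], and comparison carries convergence over from [b] to [e]. *)
  assert (Hfact : forall k, 1 <= INR (fact k)) by (intros k; apply (le_INR 1), lt_O_fact).
  assert (He0 : forall k, 0 <= e k <= b k).
  { intros k; specialize (Hfact k); pose proof (proj1 Hb k); split.
    - apply Rdiv_le_0_compat; lra.
    - apply Rle_div_l; [lra|]; nra. }
  assert (He : entire_nonneg e).
  { split; [intros k; apply He0|]; intros y Hy.
    destruct (proj2 Hb y Hy) as [l Hl]; apply is_pseries_R in Hl.
    assert (Hex : ex_series (fun k => e k * y ^ k)).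
    { apply (ex_series_le (V := R_CompleteNormedModule)) with (fun k => b k * y ^ k);
        [|now exists l].
      intros k; pose proof (pow_lt y k Hy); change (norm ?u) with (Rabs u).
      rewrite Rabs_pos_eq by (apply Rmult_le_pos; [apply He0|lra]).
      apply Rmult_le_compat_r; [lra|apply He0]. }
    destruct Hex as [l' Hl']; exists l'; now apply is_pseries_R. }
  exists (PSeries e); split; [now apply entire_absolutely_monotonic|].
  intros x Hx; apply (laplace_integral_iff f (PSeries e) e x He); auto.
  apply is_lim_laplace_to; auto.
  assert (Hix : 0 < / x) by now apply Rinv_0_lt_compat.
  pose proof (PSeries_correct b (/ x) (proj2 Hb _ Hix)) as H.
  apply is_pseries_R, (is_series_scal (/ x)) in H.
  replace (f x) with (scal (/ x) (PSeries b (/ x)))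
    by (rewrite Hf by exact Hx; apply Rmult_comm).
  refine (is_series_ext _ _ _ _ H).
  intros k; symmetry; now apply laplace_coef_term.
Qed.

Lemma laurent_form_expansion (f : R -> R) (b : nat -> R) (n : nat) (x : R) :
  laurent_form f b -> 0 < x ->
  f x = sum_n_m (fun k => b (k - 1)%nat / x ^ k) 1 n + PSeries (PS_decr_n b n) (/ x) / x ^ S n.
Proof.
  intros [Hb Hf] Hx.
  assert (Hxn : x ^ n <> 0) by (apply pow_nonzero; lra).
  (* [PSeries_taylor_head] splits off at least one term, so the empty sum is treated apart. *)
  destruct n as [|n].
  - rewrite sum_n_m_zero by lia; rewrite Hf by exact Hx.
    rewrite pow_1; symmetry; apply Rplus_0_l.
  - rewrite Hf, (PSeries_taylor_head b n (/ x) Hb) by exact Hx.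
    rewrite <- (sum_n_m_S (fun k => b (k - 1)%nat / x ^ k)).
    change (sum_n_m (fun k => b (S k - 1)%nat / x ^ S k) 0 n)
      with (sum_n (fun k => b (S k - 1)%nat / x ^ S k) n).
    rewrite sum_n_Reals, Rdiv_plus_distr; f_equal.
    + unfold Rdiv; rewrite Rmult_comm, scal_sum; apply sum_eq; intros k _.
      rewrite Nat.sub_succ, Nat.sub_0_r, pow_inv; simpl pow.
      assert (x ^ k <> 0) by (apply pow_nonzero; lra); field; lra.
    + rewrite pow_inv; change (x ^ S (S n)) with (x * x ^ S n); field; lra.
Qed.

Lemma laurent_form_remainders (f : R -> R) (b : nat -> R) :
  laurent_form f b ->
  exists a : nat -> R,
    (forall k, (1 <= k)%nat -> 0 <= a k) /\
    forall n : nat, exists Rn : R -> R,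
      completely_monotonic_of_order (INR n) Rn /\
      forall x, 0 < x -> f x = sum_n_m (fun k => a k / x ^ k) 1 n + Rn x.
Proof.
  intros Hfb; pose proof (proj1 Hfb) as Hb.
  exists (fun k => b (k - 1)%nat); split; [intros k _; apply Hb|].
  intros n; exists (fun x => PSeries (PS_decr_n b n) (/ x) / x ^ S n); split.
  (* Multiplying the remainder by [x^n] leaves one factor [1/x], which [PS_incr_1] absorbs into an
     entire series in [1/x]. *)
  - apply (completely_monotonic_ext (fun x => PSeries (PS_incr_1 (PS_decr_n b n)) (/ x))).
    + intros x Hx; rewrite PSeries_incr_1, Rpower_pow by exact Hx; simpl pow.
      assert (x ^ n <> 0) by (apply pow_nonzero; lra); field; lra.
    + now apply entire_inv_completely_monotonic, entire_nonneg_incr_1, entire_nonneg_decr_n.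
  - intros x Hx; now apply laurent_form_expansion.
Qed.

(** * From sign conditions to the entire series *)

Lemma derivs_inv_step (A A' : R -> R) (n : nat) (y : R) :
  0 < y -> is_derive A (/ y) ((A' (/ y) - INR (S n) * A (/ y)) / (/ y)) ->
  is_derive (fun y => (-1) ^ n * (A (/ y) / y ^ S n)) y ((-1) ^ S n * (A' (/ y) / y ^ S (S n))).
Proof.
  intros Hy HA.
  replace ((-1) ^ S n * (A' (/ y) / y ^ S (S n)))
    with ((-1) ^ n * (- (A' (/ y) / y ^ S (S n)))) by (simpl ((-1) ^ S n); ring).
  apply is_derive_scal.
  assert (Hp : is_derive (fun y => y ^ S n) y (INR (S n) * 1 * y ^ n))
    by exact (is_derive_pow (fun y => y) (S n) y 1 (is_derive_id y)).
  assert (Hi : is_derive (fun y => / y) y (- / y ^ 2)) by (auto_derive; [lra|field; lra]).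
  assert (Hyn : 0 < y ^ n) by now apply pow_lt.
  pose proof (is_derive_div _ _ _ _ _ (is_derive_comp A (fun y => / y) y _ _ HA Hi) Hp) as H.
  assert (Hyn' : y ^ S n <> 0) by (apply pow_nonzero; lra).
  specialize (H Hyn').
  (* The multiple [(n+1) A] coming from [HA] through the chain rule cancels the one coming from the
     derivative of [y^(n+1)], and only [A'] remains. *)
  refine (eq_ind _ (is_derive _ y) H _ _).
  unfold scal; simpl; unfold mult; simpl.
  generalize (match n with 0%nat => 1 | S _ => INR n + 1 end); intros c.
  field; lra.
Qed.

(* With [A_n = (x ^ n f)^(n)], the relation [x A_n' = A_(n+1) - (n+1) A_n] says that
   [(-1) ^ n A_n (1/y) / y ^ (n+1)] is the [n]-th derivative of [f (1/y) / y]. *)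
Lemma laurent_form_of_alternating (f : R -> R) :
  (forall k : nat,
     derivable_up_to k (fun y => y ^ k * f y) /\
     forall x, 0 < x -> 0 <= (-1) ^ k * Derive_n (fun y => y ^ k * f y) k x) ->
  exists b, laurent_form f b.
Proof.
  intros Hf.
  set (A := fun n => Derive_n (fun y => y ^ n * f y) n).
  assert (HA : forall n x, 0 < x -> is_derive (A n) x ((A (S n) x - INR (S n) * A n x) / x)).
  { intros n x Hx.
    (* The condition at [n] stops at order [n]; one more derivative of [x^n f] comes from the
       condition at [n+1], by writing it as [x^(n+1) f] divided by [x]. *)
    pose proof (derivable_derivs_upto _ _ (proj1 (Hf (S n)))) as H.
    apply derivs_upto_quotient in H.
    set (Q := quotient_derivs (Derive_n (fun y => y ^ S n * f y))) in H.
    assert (HQ : derivs_upto (S n) (fun y => y ^ n * f y) Q).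
    { refine (derivs_upto_ext _ _ _ _ _ H).
      intros y Hy; simpl; field; lra. }
    assert (HAQ : forall y, 0 < y -> Q n y = A n y).
    { intros y Hy; symmetry; apply (derivs_upto_Derive_n (S n) _ _ HQ); [lia|exact Hy]. }
    rewrite <- HAQ by exact Hx.
    apply is_derive_ext_pos with (Q n); [exact Hx|exact HAQ|].
    apply (proj2 HQ); [lia|exact Hx]. }
  assert (H : nonneg_derivs (fun y => f (/ y) / y)
                (fun n y => (-1) ^ n * (A n (/ y) / y ^ S n))).
  { split.
    - intros n; split.
      + intros y Hy; unfold A; simpl; field; lra.
      + intros k y _ Hy; apply (derivs_inv_step (A k)); [exact Hy|].
        apply HA; now apply Rinv_0_lt_compat.
    - intros n y Hy; unfold Rdiv; rewrite <- Rmult_assoc; apply Rmult_le_pos.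
      + apply Hf; now apply Rinv_0_lt_compat.
      + apply Rlt_le, Rinv_0_lt_compat; now apply pow_lt. }
  destruct (nonneg_derivs_pseries _ _ H) as [b [Hb0 Hb]].
  exists b; split; [split; [exact Hb0|]|].
  - intros y Hy; exists (f (/ y) / y); exact (Hb y Hy).
  - intros x Hx; rewrite (is_pseries_unique _ _ _ (Hb (/ x) (Rinv_0_lt_compat x Hx))).
    rewrite Rinv_inv; field; lra.
Qed.

Lemma alternating_of_odd_derivs (f : R -> R) :
  (forall x, 0 < x -> 0 <= f x) ->
  (forall k : nat, (1 <= k)%nat ->
     derivable_up_to (2 * k - 1) (fun y => y ^ k * f y) /\
     forall x, 0 < x -> Derive_n (fun y => y ^ k * f y) (2 * k - 1) x <= 0) ->
  forall k : nat,
    derivable_up_to k (fun y => y ^ k * f y) /\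
    forall x, 0 < x -> 0 <= (-1) ^ k * Derive_n (fun y => y ^ k * f y) k x.
Proof.
  intros Hf0 Hf [|k].
  - split; [intros [|j] x Hj Hx; [exact I|lia]|].
    intros x Hx; simpl; specialize (Hf0 x Hx); lra.
  - destruct (Hf (S k) ltac:(lia)) as [Hd Hn].
    pose proof (derivable_derivs_upto _ _ Hd) as HG.
    split; [intros j x Hj Hx; apply Hd; [lia|exact Hx]|].
    intros x Hx.
    destruct (Hf 1%nat (le_n 1)) as [Hd1 Hn1].
    pose proof (derivable_derivs_upto _ _ Hd1) as HG1.
    (* The condition of index [1] says that [x f] is nonincreasing, hence at most [f 1] beyond
       [1]. *)
    assert (Hb : forall y, 1 <= y -> Rabs (y ^ S k * f y) <= f 1 * y ^ k).
    { intros y Hy; pose proof (pow_lt y k ltac:(lra)) as Hyk.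
      pose proof (Hf0 y ltac:(lra)) as Hfy.
      assert (Hmono : y ^ 1 * f y <= 1 ^ 1 * f 1).
      { refine (nonincreasing_of_derive (fun y => y ^ 1 * f y)
                  (Derive_n (fun y => y ^ 1 * f y) 1) 1 _ _ 1 y (Rle_refl 1) Hy).
        - intros t Ht; apply (proj2 HG1); [lia|lra].
        - intros t Ht; apply Hn1; lra. }
      rewrite Rabs_pos_eq; [|apply Rmult_le_pos; [apply pow_le|]; lra].
      replace (y ^ S k * f y) with (y ^ 1 * f y * y ^ k) by (simpl; ring).
      apply Rmult_le_compat_r; lra. }
    (* The descent starts at the odd order [2k+1], where (v) gives the sign, and reaches the wanted
       order [k+1], just above the growth exponent [k]. *)
    refine (alternating_derivs_descend (2 * S k - 1) k _ _ (f 1) HG Hb _ (S k) x _ Hx); [|lia].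
    intros y Hy; specialize (Hn y Hy).
    replace ((-1) ^ (2 * S k - 1)) with (-1); [lra|].
    replace (2 * S k - 1)%nat with (S (2 * k)) by lia; symmetry; apply pow_1_odd.
Qed.

(** * From remainders to sign conditions, and the equivalence *)

Lemma remainders_odd_derivs (f : R -> R) (a : nat -> R) :
  (forall n : nat, exists Rn : R -> R,
     completely_monotonic_of_order (INR n) Rn /\
     forall x, 0 < x -> f x = sum_n_m (fun k => a k / x ^ k) 1 n + Rn x) ->
  (forall x, 0 < x -> 0 <= f x) /\
  forall k : nat, (1 <= k)%nat ->
    derivable_up_to (2 * k - 1) (fun y => y ^ k * f y) /\
    forall x, 0 < x -> Derive_n (fun y => y ^ k * f y) (2 * k - 1) x <= 0.
Proof.
  intros Hf; split.
  (* For [n = 0] the sum is empty, so [f] coincides with a completely monotonic remainder. *)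
  - intros x Hx; destruct (Hf 0%nat) as [R0 [[_ Hs] H0]].
    specialize (Hs 0%nat x Hx); simpl in Hs; rewrite Rpower_O in Hs by exact Hx.
    rewrite H0, sum_n_m_zero by (exact Hx || lia).
    change (@zero _) with 0; lra.
  - intros k Hk; destruct (Hf k) as [Rk [Hcm Hk']].
    destruct (laurent_remainder_derivs f a Rk k Hcm Hk') as [Hd HD].
    (* For [k >= 1] the order [2k-1] is at least [k], so the polynomial part is gone; this order
       being odd, the sign is nonpositive. *)
    split; [apply Hd|]; intros x Hx; rewrite HD by (exact Hx || lia).
    pose proof (proj2 Hcm (2 * k - 1)%nat x Hx) as Hs.
    replace (2 * k - 1)%nat with (S (2 * (k - 1))) in * by lia.
    rewrite pow_1_odd in Hs; lra.
Qed.

Lemma remainders_alternating (f : R -> R) (a : nat -> R) :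
  (forall n : nat, exists Rn : R -> R,
     completely_monotonic_of_order (INR n) Rn /\
     forall x, 0 < x -> f x = sum_n_m (fun k => a k / x ^ k) 1 n + Rn x) ->
  forall k : nat,
    derivable_up_to k (fun y => y ^ k * f y) /\
    completely_monotonic (fun x => (-1) ^ k * Derive_n (fun y => y ^ k * f y) k x).
Proof.
  intros Hf k; destruct (Hf k) as [Rk [Hcm Hk]].
  destruct (laurent_remainder_derivs f a Rk k Hcm Hk) as [Hd HD]; split; [apply Hd|].
  refine (completely_monotonic_ext _ _ _ (completely_monotonic_derivative _ k Hcm)).
  intros x Hx; now rewrite HD.
Qed.

Theorem theorem1p1 (f : R -> R) :
  seq.all_iff
    (exists phi : R -> R,
        absolutely_monotonic phi /\
        forall x, 0 < x ->
          is_RInt_gen (fun t => exp (- (x * t)) * phi t)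
            (at_point 0) (Rbar_locally p_infty) (f x))
    [ (exists a : nat -> R,
         (forall k, (1 <= k)%nat -> 0 <= a k) /\
         forall n : nat, exists Rn : R -> R,
           completely_monotonic_of_order (INR n) Rn /\
           forall x, 0 < x -> f x = sum_n_m (fun k => a k / x ^ k) 1 n + Rn x);
      (forall k : nat,
         derivable_up_to k (fun y => y ^ k * f y) /\
         completely_monotonic
           (fun x => (-1) ^ k * Derive_n (fun y => y ^ k * f y) k x));
      (forall k : nat,
         derivable_up_to k (fun y => y ^ k * f y) /\
         forall x, 0 < x -> 0 <= (-1) ^ k * Derive_n (fun y => y ^ k * f y) k x);
      ((forall x, 0 < x -> 0 <= f x) /\
       forall k : nat, (1 <= k)%nat ->
         derivable_up_to (2 * k - 1) (fun y => y ^ k * f y) /\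
         forall x, 0 < x -> Derive_n (fun y => y ^ k * f y) (2 * k - 1) x <= 0) ].
Proof.
  (* [all_iff] unfolds to the cycle from (i) through (ii), (iii), (iv), (v) back to (i). *)
  split; [|split; [|split; [|split]]].
  - intros [phi [Hphi Hf]].
    destruct (laurent_form_of_laplace f phi Hphi Hf) as [b Hb].
    exact (laurent_form_remainders f b Hb).
  - intros [a [_ Ha]]; exact (remainders_alternating f a Ha).
  - intros Hf k; destruct (Hf k) as [Hd [_ Hs]]; split; [exact Hd|].
    intros x Hx; specialize (Hs 0%nat x Hx); simpl in Hs; lra.
  (* For [k > 1], (v) concerns an order above [k], on which (iv) is silent, so the series is
     recovered first. *)
  - intros Hf; destruct (laurent_form_of_alternating f Hf) as [b Hb].
    destruct (laurent_form_remainders f b Hb) as [a [_ Ha]].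
    exact (remainders_odd_derivs f a Ha).
  - intros [Hf0 Hf].
    destruct (laurent_form_of_alternating f (alternating_of_odd_derivs f Hf0 Hf)) as [b Hb].
    exact (laplace_of_laurent_form f b Hb).
Qed.
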